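(* Let $\mathcal K$ and $\varpi(\cdot)$ be as in the context, $U\in\mathbb S^n_{\succ0}$, and let $\boldsymbol f(\cdot)\in\mathcal L^2_\varpi(\mathcal K;\mathbb R^d)$ satisfy $\int_{\mathcal K}\varpi(\tau)\boldsymbol f(\tau)\boldsymbol f^\top(\tau)d\tau\succ0$; put $F(\tau)=\boldsymbol f(\tau)\otimes I_n$ and $\mathsf F^{-1}=\int_{\mathcal K}\varpi(\tau)\boldsymbol f(\tau)\boldsymbol f^\top(\tau)d\tau$. Then for all $\boldsymbol x(\cdot)\in\mathcal L^2_\varpi(\mathcal K;\mathbb R^n)$, all $\boldsymbol\zeta\in\mathbb R^\nu$ and $\Omega\in\mathbb R^{dn\times\nu}$ with $\Omega\boldsymbol\zeta=\int_{\mathcal K}\varpi(\tau)F(\tau)\boldsymbol x(\tau)d\tau$, and all $H\in\mathbb R^{dn\times\nu}$, $$\int_{\mathcal K}\varpi(\tau)\boldsymbol x^\top(\tau)U\boldsymbol x(\tau)d\tau\ \ge\ \boldsymbol\zeta^\top\left[\mathsf{Sy}(H^\top\Omega)-H^\top(\mathsf F^{-1}\otimes U^{-1})H\right]\boldsymbol\zeta .$$ Moreover, with $H=(\mathsf F\otimes U)\Omega$ this inequality becomes identical to $$\int_{\mathcal K}\varpi\,\boldsymbol x^\top U\boldsymbol x\,d\tau\ \ge\ \int_{\mathcal K}\varpi\,\boldsymbol x^\top F^\top d\tau\,(\mathsf F\otimes U)\int_{\mathcal K}\varpi F\boldsymbol x\,d\tau,$$ and for this choice of $H$ the lower bound (right-hand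 side) of the first inequality attains its maximum over $H$.
   Context: $\mathcal K\subseteq\mathbb R\cup\{\pm\infty\}$ has nonzero Lebesgue measure; $\varpi:\mathcal K\to\mathbb R_{\ge0}$ is measurable with only finitely or countably infinitely many zeros. $\mathcal L^2_\varpi(\mathcal K;\mathbb R^d)$ is the set of measurable $\boldsymbol\phi:\mathcal K\to\mathbb R^d$ with $\int_{\mathcal K}\varpi\boldsymbol\phi^\top\boldsymbol\phi\,d\tau<\infty$. $\mathsf{Sy}(X)=X+X^\top$; $\otimes$: Kronecker product; $\mathbb S^n_{\succ0}$: real symmetric positive definite $n\times n$ matrices. *)

(* Defs.v *)
From mathcomp Require Import all_boot all_order all_algebra.
From mathcomp Require Import all_classical all_reals all_analysis.
From mathcomp Require Export mxtens.

Set Implicit Arguments.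
Unset Strict Implicit.
Unset Printing Implicit Defensive.

Import Order.TTheory GRing.Theory Num.Theory.
Import numFieldNormedType.Exports.

Local Open Scope classical_set_scope.
Local Open Scope ring_scope.

Section ExtendedDomain.
Variable R : realType.

(* The real line equipped with the Lebesgue (not merely Borel) sigma-algebra,
   i.e., the domain of [completed_lebesgue_measure]. *)
Definition lebesgueType := caratheodory_type (@wlength R idfun)^*%mu.

Local Notation mu := (@completed_lebesgue_measure R).

Implicit Types K : set (\bar R).

(* A domain [K] may contain -oo and +oo. These two points are measurable and of
   measure zero, so that measurability and integration on [K] are those on its
   trace on the real line. A function on [K] is represented by a function on
   [\bar R] whose values outside of [K] are irrelevant. *)
Definition trace K : set lebesgueType := [set t | K (t : R)%:E].

Definition lebesgue_measurable K : Prop := measurable (trace K).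

Definition lebesgue_mes K : \bar R := mu (trace K).

Definition lebesgue_measurable_fun K (g : \bar R -> R) : Prop :=
  measurable_fun (trace K) (fun t : lebesgueType => g (t : R)%:E).

Definition integ K (g : \bar R -> R) : R :=
  \int[mu]_(t in trace K) g (t : R)%:E.

Definition mxinteg K p q (M : \bar R -> 'M[R]_(p, q)) : 'M[R]_(p, q) :=
  \matrix_(i, j) integ K (fun t => M t i j).

Definition L2w K (w : \bar R -> R) d (phi : \bar R -> 'cV[R]_d) : Prop :=
  (forall i, lebesgue_measurable_fun K (fun t => phi t i 0)) /\
  (\int[mu]_(t in trace K)
     (w (t : R)%:E * ((phi (t : R)%:E)^T *m phi (t : R)%:E) 0 0)%:E < +oo)%E.

End ExtendedDomain.

Definition posdefmx (R : realType) n (A : 'M[R]_n) : Prop :=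
  A^T = A /\ forall v : 'cV[R]_n, v != 0 -> 0 < (v^T *m A *m v) 0 0.

Definition Sy (R : realType) n (X : 'M[R]_n) : 'M[R]_n := X + X^T.

(* [*t] is the Kronecker product; [1 * n] is not convertible to [n], hence the
   cast. *)
Definition kron_id (R : realType) d n (v : 'cV[R]_d) : 'M[R]_(d * n, n) :=
  castmx (erefl, mul1n n) (v *t (1%:M : 'M[R]_n)).

(* Main.v *)
Require Import Defs.
From mathcomp Require Import all_boot all_order all_algebra.
From mathcomp Require Import all_classical all_reals all_analysis.
From mathcomp Require Import measurable_realfun ring lra.

Set Implicit Arguments.
Unset Strict Implicit.
Unset Printing Implicit Defensive.

Import Order.TTheory GRing.Theory Num.Theory.

Local Open Scope classical_set_scope.
Local Open Scope ring_scope.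

(** The bound comes from completing a square pointwise.  Put y = H zeta and
    b = \int w F x = Omega zeta.  Since U is positive definite and w >= 0,

      0 <= w (x - U^-1 F^T y)^T U (x - U^-1 F^T y)
         = w x^T U x - y^T (w F x) - (w F x)^T y + y^T (w F U^-1 F^T) y,

    and F U^-1 F^T = (f f^T) *t U^-1 because F is f *t 1.  Integrating over K
    turns the last term into y^T M y with M := Finv *t U^-1, so that
    y^T b + b^T y - y^T M y <= \int w x^T U x ([integ_square_bound]).  The left
    side is the lower bound at H, which depends on H only through y.

    The rest is the maximization of that concave quadratic in y.  With
    N := Finv^-1 *t U, the inverse of M, one has
      y^T b + b^T y - y^T M y = b^T N b - (y - N b)^T M (y - N b),
    and M is positive semidefinite, so that the maximum is b^T N b, reached at
    y = N b, that is, at H = N Omega.  Semidefiniteness of M is itself the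
    integrated bound, taken at x = 0.

    The integral splits into its four terms because each of them is integrable:
    the weighted product of two square integrable functions is dominated by the
    sum of their weighted squared norms ([L2w_integrableM]), and everything else
    is a finite linear combination of such products. *)

(** * Integrals of scalar and matrix valued functions *)

Definition integrable_on (R : realType) (K : set (\bar R)) (g : \bar R -> R) :
    Prop :=
  (@completed_lebesgue_measure R).-integrable (trace K)
    (fun t : lebesgueType R => (g (t : R)%:E)%:E).

Definition mxintegrable (R : realType) (K : set (\bar R)) p q
    (M : \bar R -> 'M[R]_(p, q)) : Prop :=
  forall i j, integrable_on K (fun t => M t i j).

Lemma integrable_on_sum (R : realType) (K : set (\bar R)) (I : Type) (s : seq I)
    (g : I -> \bar R -> R) :
  lebesgue_measurable K -> (forall i, integrable_on K (g i)) ->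
  integrable_on K (fun t => \sum_(i <- s) g i t).
Proof.
move=> mK gK; rewrite /integrable_on.
under eq_fun do rewrite -sumEFin.
by apply: integrable_sum => // i _; exact: gK.
Qed.

Lemma integrable_onZ (R : realType) (K : set (\bar R)) c (g : \bar R -> R) :
  lebesgue_measurable K -> integrable_on K g ->
  integrable_on K (fun t => c * g t).
Proof.
move=> mK gK; rewrite /integrable_on.
under eq_fun do rewrite EFinM.
exact: integrableZl.
Qed.

Lemma integD (R : realType) (K : set (\bar R)) (g h : \bar R -> R) :
  lebesgue_measurable K -> integrable_on K g -> integrable_on K h ->
  integ K (fun t => g t + h t) = integ K g + integ K h.
Proof. by move=> mK gK hK; rewrite /integ RintegralD. Qed.

Lemma integZ (R : realType) (K : set (\bar R)) c (g : \bar R -> R) :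
  lebesgue_measurable K -> integrable_on K g ->
  integ K (fun t => c * g t) = c * integ K g.
Proof. by move=> mK gK; rewrite /integ RintegralZl. Qed.

Lemma integ0 (R : realType) (K : set (\bar R)) :
  lebesgue_measurable K -> integ K (fun=> 0) = 0.
Proof. by move=> mK; rewrite /integ Rintegral_cst// mul0r. Qed.

Lemma integ_sum (R : realType) (K : set (\bar R)) (I : Type) (s : seq I)
    (g : I -> \bar R -> R) :
  lebesgue_measurable K -> (forall i, integrable_on K (g i)) ->
  integ K (fun t => \sum_(i <- s) g i t) = \sum_(i <- s) integ K (g i).
Proof.
move=> mK gK; elim: s => [|i s IHs].
  under [in LHS]eq_fun do rewrite big_nil.
  by rewrite big_nil integ0.
under [in LHS]eq_fun do rewrite big_cons.
by rewrite big_cons integD// ?IHs//; exact: integrable_on_sum.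
Qed.

Lemma mxintegrable_mul (R : realType) (K : set (\bar R)) p q r s
    (A : 'M[R]_(r, p)) (M : \bar R -> 'M[R]_(p, q)) (B : 'M[R]_(q, s)) :
  lebesgue_measurable K -> mxintegrable K M ->
  mxintegrable K (fun t => A *m M t *m B).
Proof.
move=> mK MK i j.
under eq_fun do (rewrite mxE; under eq_bigr do rewrite mxE mulrC mulr_sumr).
apply: integrable_on_sum => // k; apply: integrable_on_sum => // l.
by apply: integrable_onZ => //; apply: integrable_onZ.
Qed.

Lemma mxinteg_mul (R : realType) (K : set (\bar R)) p q r s
    (A : 'M[R]_(r, p)) (M : \bar R -> 'M[R]_(p, q)) (B : 'M[R]_(q, s)) :
  lebesgue_measurable K -> mxintegrable K M ->
  mxinteg K (fun t => A *m M t *m B) = A *m mxinteg K M *m B.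
Proof.
move=> mK MK; apply/matrixP => i j; rewrite !mxE.
under eq_fun do (rewrite mxE; under eq_bigr do rewrite mxE mulrC mulr_sumr).
rewrite integ_sum// => [|k].
  apply: eq_bigr => k _; rewrite mxE mulrC mulr_sumr integ_sum// => [|l].
    apply: eq_bigr => l _; rewrite integZ ?integZ ?mxE//.
    exact: integrable_onZ.
  by apply: integrable_onZ => //; apply: integrable_onZ.
apply: integrable_on_sum => // l.
by apply: integrable_onZ => //; apply: integrable_onZ.
Qed.

Lemma mxintegrableD (R : realType) (K : set (\bar R)) p q
    (M N : \bar R -> 'M[R]_(p, q)) :
  lebesgue_measurable K -> mxintegrable K M -> mxintegrable K N ->
  mxintegrable K (fun t => M t + N t).
Proof.
move=> mK MK NK i j; under eq_fun do rewrite mxE.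
rewrite /integrable_on; under eq_fun do rewrite EFinD.
exact: integrableD (MK i j) (NK i j).
Qed.

Lemma mxintegD (R : realType) (K : set (\bar R)) p q
    (M N : \bar R -> 'M[R]_(p, q)) :
  lebesgue_measurable K -> mxintegrable K M -> mxintegrable K N ->
  mxinteg K (fun t => M t + N t) = mxinteg K M + mxinteg K N.
Proof.
move=> mK MK NK; apply/matrixP => i j; rewrite !mxE -integD//.
by congr integ; apply/funext => t; rewrite mxE.
Qed.

Lemma mxinteg0 (R : realType) (K : set (\bar R)) p q :
  lebesgue_measurable K -> mxinteg K (fun=> 0 : 'M[R]_(p, q)) = 0.
Proof.
move=> mK; apply/matrixP => i j; rewrite !mxE.
rewrite -[RHS](integ0 mK).
by congr integ; apply/funext => t; rewrite mxE.
Qed.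

Lemma mxinteg_tr (R : realType) (K : set (\bar R)) p q
    (M : \bar R -> 'M[R]_(p, q)) :
  mxinteg K (fun t => (M t)^T) = (mxinteg K M)^T.
Proof.
apply/matrixP => i j; rewrite !mxE.
by congr integ; apply/funext => t; rewrite mxE.
Qed.

(** * Square integrable functions *)

Lemma lebesgue_measurable_funM (R : realType) (K : set (\bar R))
    (g h : \bar R -> R) :
  lebesgue_measurable_fun K g -> lebesgue_measurable_fun K h ->
  lebesgue_measurable_fun K (fun t => g t * h t).
Proof. exact: measurable_funM. Qed.

Lemma L2w_integrable (R : realType) (K : set (\bar R)) (w : \bar R -> R) d
    (phi : \bar R -> 'cV[R]_d) :
  (forall t, K t -> 0 <= w t) -> lebesgue_measurable_fun K w -> L2w K w phi ->
  integrable_on K (fun t => w t * ((phi t)^T *m phi t) 0 0).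
Proof.
move=> w0 mw [mphi phioo]; apply/integrableP; split.
  suff : lebesgue_measurable_fun K (fun t => w t * ((phi t)^T *m phi t) 0 0).
    by move=> mwphi; apply/measurable_EFinP; exact: mwphi.
  apply: lebesgue_measurable_funM => //; rewrite /lebesgue_measurable_fun.
  under eq_fun do (rewrite mxE; under eq_bigr do rewrite mxE).
  by apply: measurable_sum => i; apply: measurable_funM; exact: mphi.
rewrite (eq_integral (fun t : lebesgueType R =>
  (w (t : R)%:E * ((phi (t : R)%:E)^T *m phi (t : R)%:E) 0 0)%:E))// => t tK.
rewrite /= ger0_norm// mulr_ge0//; first by apply: w0; exact: set_mem tK.
by rewrite mxE sumr_ge0// => i _; rewrite mxE -expr2 sqr_ge0.
Qed.

Lemma sqr_le_sumsq (R : realType) d (v : 'cV[R]_d) i :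
  v i 0 ^+ 2 <= (v^T *m v) 0 0.
Proof.
rewrite mxE (bigD1 i)//= mxE -expr2 lerDl sumr_ge0// => j _.
by rewrite mxE -expr2 sqr_ge0.
Qed.

(** Dominated by w (phi^T phi + psi^T psi), since `|a b| <= a ^+ 2 + b ^+ 2.
    Entrywise, all the integrands below are combinations of such products. *)
Lemma L2w_integrableM (R : realType) (K : set (\bar R)) (w : \bar R -> R) d n
    (phi : \bar R -> 'cV[R]_d) (psi : \bar R -> 'cV[R]_n) i j :
  lebesgue_measurable K ->
  (forall t, K t -> 0 <= w t) -> lebesgue_measurable_fun K w ->
  L2w K w phi -> L2w K w psi ->
  integrable_on K (fun t => w t * (phi t i 0 * psi t j 0)).
Proof.
move=> mK w0 mw phiL2 psiL2.
apply: (@le_integrable _ _ _ _ _ mK _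
  (fun t : lebesgueType R =>
    ((w (t : R)%:E * ((phi (t : R)%:E)^T *m phi (t : R)%:E) 0 0)%:E +
    (w (t : R)%:E * ((psi (t : R)%:E)^T *m psi (t : R)%:E) 0 0)%:E)%E)).
- suff : lebesgue_measurable_fun K (fun t => w t * (phi t i 0 * psi t j 0)).
    by move=> mwphipsi; apply/measurable_EFinP; exact: mwphipsi.
  apply: lebesgue_measurable_funM => //.
  by apply: lebesgue_measurable_funM; [exact: phiL2.1|exact: psiL2.1].
- move=> t /w0 wt; rewrite /= lee_fin -mulrDr normrM [leRHS]normrM.
  rewrite (ger0_norm wt) ler_wpM2l//.
  apply: le_trans (ler_norm _).
  apply: le_trans (lerD (sqr_le_sumsq _ i) (sqr_le_sumsq _ j)).
  by rewrite ler_norml; apply/andP; split; nra.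
- by apply: integrableD => //; exact: L2w_integrable.
Qed.

(** * Kronecker products and positive definite matrices *)

Lemma mulmx_kron_idE (R : realType) d n p (v : 'cV[R]_d) (A : 'M[R]_(n, p))
    i k j :
  (kron_id n v *m A) (mxtens_index (i, k)) j = v i 0 * A k j.
Proof.
have kronE l : kron_id n v (mxtens_index (i, k)) l = v i 0 * (k == l)%:R.
  (* The columns of [kron_id n v] are those of a matrix of width 1 * n. *)
  have -> : l = cast_ord (mul1n n) (mxtens_index (@ord0 0, l)).
    exact: val_inj.
  rewrite castmxE /= cast_ord_id cast_ordK tensmxE mxE.
  by congr (_ * (k == _)%:R); apply: val_inj.
rewrite mxE (bigD1 k)//= big1 ?addr0 => [|l lk].
  by rewrite kronE eqxx mulr1.
by rewrite kronE eq_sym (negbTE lk) mulr0 mul0r.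
Qed.

(** The reason why the quadratic term of the bound is a Kronecker product: with
    v = f(t), the left-hand side is F A F^T. *)
Lemma kron_id_sandwich (R : realType) d n (v : 'cV[R]_d) (A : 'M[R]_n) :
  kron_id n v *m A *m (kron_id n v)^T = (v *m v^T) *t A.
Proof.
apply/matrixP => i j.
case: (mxtens_indexP i) => i1 i2; case: (mxtens_indexP j) => j1 j2.
rewrite tensmxE -mulmxA mulmx_kron_idE -[A]trmxK -trmx_mul mxE mulmx_kron_idE.
by rewrite !mxE big_ord1 !mxE mulrA.
Qed.

Lemma tensmx11 (R : realType) d n :
  (1%:M : 'M[R]_d) *t (1%:M : 'M[R]_n) = 1%:M.
Proof.
apply/matrixP => i j.
case: (mxtens_indexP i) => i1 i2; case: (mxtens_indexP j) => j1 j2.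
rewrite tensmxE !mxE (can_eq (@mxtens_indexK _ _)) xpair_eqE.
by rewrite -natrM mulnb.
Qed.

Lemma posdefmx_unit (R : realType) n (A : 'M[R]_n) :
  posdefmx A -> A \in unitmx.
Proof.
move=> [_ A0]; rewrite unitmxE unitfE; apply/det0P => -[v v0 vA].
have vT0 : v^T != 0.
  by apply: contraNneq v0 => /(congr1 trmx); rewrite trmxK trmx0 => ->.
by have := A0 _ vT0; rewrite trmxK vA mul0mx mxE ltxx.
Qed.

Lemma posdefmx_ge0 (R : realType) n (A : 'M[R]_n) (v : 'cV[R]_n) :
  posdefmx A -> 0 <= (v^T *m A *m v) 0 0.
Proof.
move=> [_ A0]; have [->|v0] := eqVneq v 0; last exact/ltW/A0.
by rewrite mulmx0 mxE.
Qed.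

(** * The integrated square *)

Lemma mxintegrable_kron (R : realType) (K : set (\bar R)) (w : \bar R -> R) d n
    (f : \bar R -> 'cV[R]_d) (x : \bar R -> 'cV[R]_n) :
  lebesgue_measurable K ->
  (forall t, K t -> 0 <= w t) -> lebesgue_measurable_fun K w ->
  L2w K w f -> L2w K w x ->
  mxintegrable K (fun t => w t *: (kron_id n (f t) *m x t)).
Proof.
move=> mK w0 mw fL2 xL2 i j; rewrite (ord1 j).
case: (mxtens_indexP i) => i1 i2.
under eq_fun do rewrite mxE mulmx_kron_idE.
exact: L2w_integrableM.
Qed.

Lemma mxintegrable_gram (R : realType) (K : set (\bar R)) (w : \bar R -> R) d n
    (f : \bar R -> 'cV[R]_d) (x : \bar R -> 'cV[R]_n) :
  lebesgue_measurable K ->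
  (forall t, K t -> 0 <= w t) -> lebesgue_measurable_fun K w ->
  L2w K w f -> L2w K w x ->
  mxintegrable K (fun t => w t *: (f t *m (x t)^T)).
Proof.
move=> mK w0 mw fL2 xL2 i j.
under eq_fun do rewrite mxE mxE big_ord1 mxE.
exact: L2w_integrableM.
Qed.

Lemma mxintegrable_tens (R : realType) (K : set (\bar R)) p q r s
    (M : \bar R -> 'M[R]_(p, q)) (A : 'M[R]_(r, s)) :
  lebesgue_measurable K -> mxintegrable K M ->
  mxintegrable K (fun t => M t *t A).
Proof.
move=> mK MK i j; under eq_fun do rewrite mxE mulrC.
by apply: integrable_onZ => //; exact: MK.
Qed.

Lemma mxinteg_tens (R : realType) (K : set (\bar R)) p q r s
    (M : \bar R -> 'M[R]_(p, q)) (A : 'M[R]_(r, s)) :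
  lebesgue_measurable K -> mxintegrable K M ->
  mxinteg K (fun t => M t *t A) = mxinteg K M *t A.
Proof.
move=> mK MK; apply/matrixP => i j; rewrite !mxE mulrC.
by under eq_fun do rewrite mxE mulrC; rewrite integZ.
Qed.

Lemma mxintegrable_qform (R : realType) (K : set (\bar R)) (w : \bar R -> R) n
    (A : 'M[R]_n) (x : \bar R -> 'cV[R]_n) :
  lebesgue_measurable K ->
  (forall t, K t -> 0 <= w t) -> lebesgue_measurable_fun K w ->
  L2w K w x ->
  mxintegrable K (fun t => w t *: ((x t)^T *m A *m x t)).
Proof.
move=> mK w0 mw xL2 i j.
have E t : (w t *: ((x t)^T *m A *m x t)) i j =
    \sum_k \sum_l A l k * (w t * (x t l 0 * x t k 0)).
  rewrite !ord1 mxE mxE mulr_sumr; apply: eq_bigr => k _.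
  rewrite mxE mulr_suml mulr_sumr; apply: eq_bigr => l _; rewrite mxE; ring.
under eq_fun do rewrite E.
apply: integrable_on_sum => // k; apply: integrable_on_sum => // l.
by apply: integrable_onZ => //; exact: L2w_integrableM.
Qed.

(** The square is centered at the minimizer in x of x^T U x - 2 y^T F x, which
    solves U x = F^T y. *)
Lemma complete_square (R : realType) n m (U : 'M[R]_n) (x : 'cV[R]_n)
    (F : 'M[R]_(m, n)) (y : 'cV[R]_m) :
  U^T = U -> U \in unitmx ->
  (x - invmx U *m F^T *m y)^T *m U *m (x - invmx U *m F^T *m y) =
  x^T *m U *m x - y^T *m (F *m x) - (F *m x)^T *m y
  + y^T *m (F *m invmx U *m F^T) *m y.
Proof.
move=> UT Uu; set z := invmx U *m F^T *m y.
have Uz : U *m z = F^T *m y by rewrite /z -mulmxA mulKVmx.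
have zU : z^T *m U = y^T *m F.
  by rewrite -[in LHS]UT -trmx_mul Uz trmx_mul trmxK.
rewrite [(x - z)^T]linearB /= mulmxBl zU mulmxBl !mulmxBr.
rewrite -!mulmxA Uz trmx_mul -!mulmxA opprB !addrA.
by rewrite [LHS]addrAC [X in X + _ = _]addrAC /z !mulmxA.
Qed.

(** The right-hand side minus the left-hand side is the integral over K of w
    times the square of [complete_square]. *)
Lemma integ_square_bound (R : realType) (K : set (\bar R)) (w : \bar R -> R) d n
    (U : 'M[R]_n) (f : \bar R -> 'cV[R]_d) (x : \bar R -> 'cV[R]_n)
    (y : 'cV[R]_(d * n)) :
  lebesgue_measurable K ->
  (forall t, K t -> 0 <= w t) -> lebesgue_measurable_fun K w ->
  posdefmx U -> L2w K w f -> L2w K w x ->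
  (y^T *m mxinteg K (fun t => w t *: (kron_id n (f t) *m x t))
   + (mxinteg K (fun t => w t *: (kron_id n (f t) *m x t)))^T *m y
   - y^T *m (mxinteg K (fun t => w t *: (f t *m (f t)^T)) *t invmx U) *m y) 0 0
  <= integ K (fun t => w t * ((x t)^T *m U *m x t) 0 0).
Proof.
move=> mK w0 mw Upos fL2 xL2.
set b := mxinteg K (fun t => w t *: (kron_id n (f t) *m x t)).
set G := mxinteg K (fun t => w t *: (f t *m (f t)^T)).
have Uu := posdefmx_unit Upos.
pose F t := kron_id n (f t).
have iQ := mxintegrable_qform U mK w0 mw xL2.
have ib := mxintegrable_kron mK w0 mw fL2 xL2.
have iG := mxintegrable_tens (invmx U) mK (mxintegrable_gram mK w0 mw fL2 fL2).
have ibT : mxintegrable K (fun t => (w t *: (F t *m x t))^T).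
  by move=> i j; under eq_fun do rewrite mxE; exact: ib.
have iyb := mxintegrable_mul (- y^T) 1%:M mK ib.
have iby := mxintegrable_mul 1%:M (- y) mK ibT.
have iyGy := mxintegrable_mul y^T y mK iG.
pose q t := (x t - invmx U *m (F t)^T *m y)^T *m U *m
  (x t - invmx U *m (F t)^T *m y).
have qE : (fun t => w t *: q t) = fun t =>
    w t *: ((x t)^T *m U *m x t)
    + (- y^T *m (w t *: (F t *m x t)) *m 1%:M)
    + (1%:M *m (w t *: (F t *m x t))^T *m - y)
    + y^T *m ((w t *: (f t *m (f t)^T)) *t invmx U) *m y.
  apply/funext => t; rewrite /q complete_square// ?Upos.1//.
  rewrite kron_id_sandwich !scalerDr !scalerN mulmx1 mul1mx mulNmx mulmxN.
  have -> : (w t *: (f t *m (f t)^T)) *t invmx U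
            = w t *: ((f t *m (f t)^T) *t invmx U).
    by apply/matrixP => i j; rewrite !mxE mulrA.
  by rewrite [(w t *: (F t *m x t))^T]linearZ /= -!scalemxAr -!scalemxAl.
rewrite -subr_ge0.
have lhsE : integ K (fun t => w t * ((x t)^T *m U *m x t) 0 0) =
    mxinteg K (fun t => w t *: ((x t)^T *m U *m x t)) 0 0.
  by rewrite mxE; congr integ; apply/funext => t; rewrite [in RHS]mxE.
suff -> : integ K (fun t => w t * ((x t)^T *m U *m x t) 0 0)
    - (y^T *m b + b^T *m y - y^T *m (G *t invmx U) *m y) 0 0
    = mxinteg K (fun t => w t *: q t) 0 0.
  rewrite mxE; apply: Rintegral_ge0 => t Kt; rewrite mxE mulr_ge0 ?w0//.
  exact: posdefmx_ge0.
rewrite lhsE qE !mxintegD//; try by do ?apply: mxintegrableD.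
rewrite !mxinteg_mul// mxinteg_tr mxinteg_tens; last 2 first.
- exact: mK.
- exact: mxintegrable_gram.
rewrite mulmx1 mul1mx mulNmx mulmxN -/b -/G.
move: (mxinteg K _) (y^T *m b) (b^T *m y) (_ *m y) => A B C D.
by rewrite !mxE; ring.
Qed.

(** * The optimal lower bound *)

Theorem theorem4p2 (R : realType) (d n nu : nat)
  (K : set (\bar R)) (w : \bar R -> R) (U : 'M[R]_n) (f : \bar R -> 'cV[R]_d)
  (K_measurable : lebesgue_measurable K)
  (K_nonnull : lebesgue_mes K != 0%E)
  (w_ge0 : forall t, K t -> 0 <= w t)
  (w_measurable : lebesgue_measurable_fun K w)
  (w_zeros : countable [set t | K t /\ w t = 0])
  (U_posdef : posdefmx U)
  (f_L2 : L2w K w f)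
  (f_posdef : posdefmx (mxinteg K (fun t => w t *: (f t *m (f t)^T)))) :
  let F := fun t => kron_id n (f t) in
  let Finv := mxinteg K (fun t => w t *: (f t *m (f t)^T)) in
  let sF := invmx Finv in
  forall x : \bar R -> 'cV[R]_n, L2w K w x ->
  forall (zeta : 'cV[R]_nu) (Omega : 'M[R]_(d * n, nu)),
  Omega *m zeta = mxinteg K (fun t => w t *: (F t *m x t)) ->
  let lhs := integ K (fun t => w t * ((x t)^T *m U *m x t) 0 0) in
  let lower_bound := fun H : 'M[R]_(d * n, nu) =>
    (zeta^T *m (Sy (H^T *m Omega) - H^T *m (Finv *t invmx U) *m H)
      *m zeta) 0 0 in
  let H0 := (sF *t U) *m Omega in
  let lower_bound0 :=
    (mxinteg K (fun t => w t *: ((x t)^T *m (F t)^T)) *m (sF *t U)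
      *m mxinteg K (fun t => w t *: (F t *m x t))) 0 0 in
  (forall H : 'M[R]_(d * n, nu), lower_bound H <= lhs) /\
  (lower_bound H0 = lower_bound0 /\ lower_bound0 <= lhs) /\
  (forall H : 'M[R]_(d * n, nu), lower_bound H <= lower_bound H0).
Proof.
move=> F Finv sF x x_L2 zeta Omega Omega_zeta lhs lower_bound H0 lower_bound0.
set b := mxinteg K _ in Omega_zeta.
pose M := Finv *t invmx U; pose N := sF *t U.
have MN : M *m N = 1%:M.
  by rewrite tensmx_mul mulmxV ?mulVmx ?tensmx11//; exact: posdefmx_unit.
have N_T : N^T = N by rewrite trmx_tens trmx_inv f_posdef.1 U_posdef.1.
have lower_boundE H : let y := H *m zeta in
    lower_bound H = (y^T *m b + b^T *m y - y^T *m M *m y) 0 0.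
  rewrite /lower_bound /Sy mulmxBr mulmxBl mulmxDr mulmxDl /= -Omega_zeta.
  by rewrite !trmx_mul trmxK !mulmxA.
(* At x = 0 both b and the integral of w x^T U x vanish, and the bound reads
   - z^T M z <= 0. *)
have zero_L2 : L2w K w (fun=> 0 : 'cV[R]_n).
  split=> [i|]; first exact: measurable_cst.
  under eq_integral do rewrite mulmx0 mxE mulr0.
  by rewrite integral0 ltry.
have M_ge0 (z : 'cV[R]_(d * n)) : 0 <= (z^T *m M *m z) 0 0.
  have := integ_square_bound z K_measurable w_ge0 w_measurable U_posdef f_L2
    zero_L2.
  under [X in integ K X]eq_fun do rewrite mulmx0 mxE mulr0.
  under [X in mxinteg K X]eq_fun do rewrite mulmx0 scaler0.
  rewrite integ0// mxinteg0// trmx0 mulmx0 mul0mx addr0 sub0r mxE oppr_le0.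
  exact.
have lower_bound_le H : lower_bound H <= lhs.
  by rewrite lower_boundE; exact: integ_square_bound.
have lower_bound_H0 : lower_bound H0 = (b^T *m N *m b) 0 0.
  rewrite lower_boundE /= -[H0 *m zeta]mulmxA Omega_zeta trmx_mul N_T -/N.
  by rewrite -!mulmxA (mulmxA M N) MN mul1mx addrK.
have lower_bound0E : lower_bound0 = (b^T *m N *m b) 0 0.
  rewrite /lower_bound0; suff -> : mxinteg K
      (fun t => w t *: ((x t)^T *m (F t)^T)) = b^T by [].
  rewrite /b -mxinteg_tr; congr mxinteg; apply/funext => t.
  by rewrite linearZ /= trmx_mul.
split=> //; split.
  by rewrite lower_bound0E -lower_bound_H0.
move=> H; rewrite lower_bound_H0 lower_boundE /=; set y := H *m zeta.
rewrite -subr_ge0.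
suff -> : (b^T *m N *m b) 0 0 - (y^T *m b + b^T *m y - y^T *m M *m y) 0 0
  = ((y - N *m b)^T *m M *m (y - N *m b)) 0 0 by exact: M_ge0.
have NM : N *m M = 1%:M by rewrite mulmx1C.
rewrite [(y - N *m b)^T]linearB /= (trmx_mul N b) N_T !mulmxBl.
rewrite -(mulmxA b^T N M) NM mulmx1.
rewrite !mulmxBr -[y^T *m M *m (N *m b)]mulmxA (mulmxA M) MN mul1mx.
rewrite (mulmxA b^T N b).
move: (b^T *m N *m b) (y^T *m b) (b^T *m y) (_ *m y) => A B C D.
by rewrite !mxE; ring.
Qed.
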